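(* The set of pairs $(\alpha,\beta)\in\mathbb{R}^2$ for which there exist a constant $c>0$ and an integer $N$ such that $$\max\{2,xy\}\cdot\|x\alpha+y\beta\|\cdot\bigl(\log\max\{2,xy\}\bigr)^2\ge c$$ for all positive integers $x,y$ with $xy\ge N$, has Hausdorff dimension $2$.
   Context: For a real number $x$, $\|x\|$ denotes the distance from $x$ to the nearest integer. *)

(* Defs.v *)
From Stdlib Require Import Reals Lra.
Open Scope R_scope.

Definition dist_nint (t : R) : R := Rmin (frac_part t) (1 - frac_part t).

Definition dist2 (p q : R * R) : R :=
  sqrt ((fst p - fst q) ^ 2 + (snd p - snd q) ^ 2).

Definition diam_le (U : R * R -> Prop) (r : R) : Prop :=
  forall p q, U p -> U q -> dist2 p q <= r.

Definition hausdorff_null (s : R) (E : R * R -> Prop) : Prop :=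
  forall eps, 0 < eps ->
    exists (U : nat -> R * R -> Prop) (r : nat -> R) (l : R),
      (forall p, E p -> exists n, U n p) /\
      (forall n, 0 < r n /\ diam_le (U n) (r n)) /\
      infinite_sum (fun n => Rpower (r n) s) l /\ l < eps.

Definition is_glb (S : R -> Prop) (d : R) : Prop :=
  (forall s, S s -> d <= s) /\ (forall b, (forall s, S s -> b <= s) -> b <= d).

Definition hausdorff_dim (E : R * R -> Prop) (d : R) : Prop :=
  is_glb (fun s => 0 <= s /\ hausdorff_null s E) d.

Definition badly_approx_set : R * R -> Prop :=
  fun ab =>
    exists (c : R) (N : Z), 0 < c /\
      forall x y : nat, (0 < x)%nat -> (0 < y)%nat ->
        IZR N <= INR x * INR y ->
        let M := Rmax 2 (INR x * INR y) in
        M * dist_nint (INR x * fst ab + INR y * snd ab) * (ln M) ^ 2 >= c.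

(* Main.v *)
Require Import Defs.
From Stdlib Require Import Reals Lra Lia ZArith Arith Psatz ClassicalEpsilon.
Open Scope R_scope.

(** A Peres-Schlag argument.  Put [B_(i+1) = B_i ^ 8] and cut the unit square into
    squares of side [B_i ^ (-3)].  Going to level [i + 2], remove the squares that
    come close to a line [x alpha + y beta = p] with [B_(i+1) <= x y < B_(i+2)].
    These lines are so closely spaced that they are equidistributed in each square
    of level [i], of which they remove a proportion at most
    [O(c) * sum 1 / (x y ln^2 (x y))]; the sum is bounded independently of [i],
    because [(ln B_(i+2))^2 = 64 (ln B_(i+1))^2].  Hence at least half of what is
    left survives each level, a proportion [2^(-i)] in total, while the squares
    have side doubly exponentially small in [i].

    Given a cover of the set by sets of diameters [r_n] with small [sum r_n ^ s],
    [s < 2], the squares which meet a covering set of comparable diameter are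
    removed as well; their total area at level [i + 2] is at most
    [O(B_(i+1)^(-3 (2 - s)))], negligible against [2^(-i)].  By compactness a point survives: it lies in the
    set and in no covering set. *)

(** * Finite sums and counting *)

Fixpoint rsum (n : nat) (f : nat -> R) : R :=
  match n with
  | O => 0
  | S m => rsum m f + f m
  end.

Definition sum2 (n : nat) (f : nat -> nat -> R) : R :=
  rsum n (fun a => rsum n (f a)).

Definition indic (P : Prop) : R :=
  if excluded_middle_informative P then 1 else 0.

Lemma rsum_ext n f g :
  (forall k, (k < n)%nat -> f k = g k) -> rsum n f = rsum n g.
Proof.
  induction n as [|n IH]; intros H; simpl; [reflexivity|].
  rewrite IH, H by (intros; try apply H; lia); reflexivity.
Qed.

Lemma rsum_le n f g :
  (forall k, (k < n)%nat -> f k <= g k) -> rsum n f <= rsum n g.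
Proof.
  induction n as [|n IH]; intros H; simpl; [lra|].
  apply Rplus_le_compat; [apply IH; intros; apply H; lia | apply H; lia].
Qed.

Lemma rsum_plus n f g : rsum n (fun k => f k + g k) = rsum n f + rsum n g.
Proof. induction n as [|n IH]; simpl; [lra | rewrite IH; lra]. Qed.

Lemma rsum_scal n c f : rsum n (fun k => c * f k) = c * rsum n f.
Proof. induction n as [|n IH]; simpl; [lra | rewrite IH; lra]. Qed.

Lemma rsum_const n c : rsum n (fun _ => c) = INR n * c.
Proof.
  induction n as [|n IH]; [simpl; lra|].
  rewrite S_INR; simpl; rewrite IH; lra.
Qed.

Lemma rsum_nonneg n f : (forall k, (k < n)%nat -> 0 <= f k) -> 0 <= rsum n f.
Proof.
  intros H; replace 0 with (rsum n (fun _ => 0)) by (rewrite rsum_const; lra).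
  now apply rsum_le.
Qed.

Lemma rsum_le_index n m f :
  (forall k, 0 <= f k) -> (n <= m)%nat -> rsum n f <= rsum m f.
Proof.
  intros H; induction 1 as [|m _ IH]; simpl; [lra | specialize (H m); lra].
Qed.

Lemma rsum_exchange n m f :
  rsum n (fun a => rsum m (f a)) = rsum m (fun b => rsum n (fun a => f a b)).
Proof.
  induction n as [|n IH]; simpl.
  - rewrite rsum_const; lra.
  - now rewrite IH, rsum_plus.
Qed.

Lemma rsum_add n m f : rsum (n + m) f = rsum n f + rsum m (fun k => f (n + k)%nat).
Proof.
  induction m as [|m IH]; simpl.
  - rewrite Nat.add_0_r; lra.
  - rewrite Nat.add_succ_r; simpl; rewrite IH; lra.
Qed.

Lemma rsum_first n f : rsum (S n) f = f O + rsum n (fun k => f (S k)).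
Proof.
  change (S n) with (1 + n)%nat; rewrite rsum_add; simpl; lra.
Qed.

Lemma rsum_block m k f :
  rsum (m * k) f = rsum m (fun q => rsum k (fun u => f (q * k + u)%nat)).
Proof.
  induction m as [|m IH]; [reflexivity|].
  replace (S m * k)%nat with (m * k + k)%nat by lia.
  rewrite rsum_add, IH; reflexivity.
Qed.

Lemma sum2_ext n f g :
  (forall a b, (a < n)%nat -> (b < n)%nat -> f a b = g a b) ->
  sum2 n f = sum2 n g.
Proof. intros H; apply rsum_ext; intros; apply rsum_ext; auto. Qed.

Lemma sum2_le n f g :
  (forall a b, (a < n)%nat -> (b < n)%nat -> f a b <= g a b) ->
  sum2 n f <= sum2 n g.
Proof. intros H; apply rsum_le; intros; apply rsum_le; auto. Qed.

Lemma sum2_plus n f g :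
  sum2 n (fun a b => f a b + g a b) = sum2 n f + sum2 n g.
Proof.
  unfold sum2; rewrite <- rsum_plus; apply rsum_ext; intros; apply rsum_plus.
Qed.

Lemma sum2_scal n c f : sum2 n (fun a b => c * f a b) = c * sum2 n f.
Proof.
  unfold sum2; rewrite <- rsum_scal; apply rsum_ext; intros; apply rsum_scal.
Qed.

Lemma sum2_const n c : sum2 n (fun _ _ => c) = INR n ^ 2 * c.
Proof.
  unfold sum2; rewrite (rsum_ext n _ (fun _ => INR n * c))
    by (intros; apply rsum_const).
  rewrite rsum_const; ring.
Qed.

Lemma sum2_prod n f g : sum2 n (fun a b => f a * g b) = rsum n f * rsum n g.
Proof.
  unfold sum2.
  rewrite (rsum_ext n _ (fun a => rsum n g * f a))
    by (intros; rewrite rsum_scal; ring).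
  rewrite rsum_scal; ring.
Qed.

Lemma sum2_swap n f : sum2 n f = sum2 n (fun a b => f b a).
Proof. apply rsum_exchange. Qed.

Lemma sum2_rsum n m f :
  sum2 n (fun a b => rsum m (fun k => f k a b)) = rsum m (fun k => sum2 n (f k)).
Proof.
  unfold sum2.
  rewrite (rsum_ext n _ (fun a => rsum m (fun k => rsum n (f k a))))
    by (intros; apply rsum_exchange).
  now rewrite rsum_exchange.
Qed.

Lemma sum2_block m k f :
  sum2 (m * k) f =
  sum2 m (fun A B => sum2 k (fun u v => f (A * k + u)%nat (B * k + v)%nat)).
Proof.
  unfold sum2; rewrite rsum_block; apply rsum_ext; intros A _.
  rewrite (rsum_ext k _ (fun u => rsum m (fun B => rsum k
    (fun v => f (A * k + u)%nat (B * k + v)%nat))))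
    by (intros; apply rsum_block).
  apply rsum_exchange.
Qed.

Lemma indic_true P : P -> indic P = 1.
Proof. unfold indic; destruct excluded_middle_informative; tauto. Qed.

Lemma indic_false P : ~ P -> indic P = 0.
Proof. unfold indic; destruct excluded_middle_informative; tauto. Qed.

Lemma indic_nonneg P : 0 <= indic P.
Proof. unfold indic; destruct excluded_middle_informative; lra. Qed.

Lemma indic_le_1 P : indic P <= 1.
Proof. unfold indic; destruct excluded_middle_informative; lra. Qed.

Lemma indic_le (P : Prop) z : 0 <= z -> (P -> 1 <= z) -> indic P <= z.
Proof. unfold indic; destruct excluded_middle_informative; intros; auto. Qed.

Lemma rsum_ge_term n f k :
  (forall j, 0 <= f j) -> (k < n)%nat -> f k <= rsum n f.
Proof.
  intros H Hk; apply Rle_trans with (rsum (S k) f).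
  - simpl; assert (0 <= rsum k f) by (apply rsum_nonneg; auto); lra.
  - apply rsum_le_index; auto.
Qed.

Lemma indic_ex_le n (P : Prop) (Q : nat -> Prop) :
  (P -> exists k, (k < n)%nat /\ Q k) -> indic P <= rsum n (fun k => indic (Q k)).
Proof.
  intros H; apply indic_le.
  - apply rsum_nonneg; intros; apply indic_nonneg.
  - intros [k [Hk HQ]]%H; rewrite <- (indic_true (Q k)) by assumption.
    apply (rsum_ge_term n (fun j => indic (Q j))); auto using indic_nonneg.
Qed.

Lemma count_le_bound n D :
  0 <= D -> rsum n (fun u => indic (INR u <= D)) <= D + 1.
Proof.
  intros HD; induction n as [|n IH]; simpl; [lra|].
  destruct (Rle_dec (INR n) D) as [h|h].
  - rewrite (indic_true _ h).
    assert (rsum n (fun u => indic (INR u <= D)) <= INR n * 1).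
    { rewrite <- rsum_const; apply rsum_le; intros; apply indic_le_1. }
    lra.
  - rewrite (indic_false _ h); lra.
Qed.

(** The smallest index satisfying [P] is within [D] of all the others; the induction shifts [P]
    until that index is [0], where [count_le_bound] applies. The bound on [INR u - INR v] needs no
    absolute value because [u] and [v] may be exchanged. *)
Lemma count_pairwise_close n (P : nat -> Prop) D :
  0 <= D -> (forall u v, P u -> P v -> INR u - INR v <= D) ->
  rsum n (fun u => indic (P u)) <= D + 1.
Proof.
  intros HD; revert P; induction n as [|n IH]; intros P HP; [simpl; lra|].
  destruct (classic (P O)) as [h|h].
  - apply Rle_trans with (2 := count_le_bound (S n) D HD).
    apply rsum_le; intros u _; apply indic_le; [apply indic_nonneg|].
    intros hu; rewrite indic_true; [lra|].
    specialize (HP u O hu h); simpl in HP; lra.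
  - rewrite rsum_first, (indic_false _ h), Rplus_0_l.
    apply IH; intros u v hu hv.
    specialize (HP _ _ hu hv); rewrite !S_INR in HP; lra.
Qed.

Lemma nat_ceil t : 0 <= t -> exists n : nat, t < INR n <= t + 1.
Proof.
  intros Ht; destruct (archimed t) as [h1 h2].
  exists (Z.to_nat (up t)); rewrite INR_IZR_INZ, Z2Nat.id; [lra|].
  apply le_IZR; lra.
Qed.

(** The progression [th * u + s] can come within [w] of at most [th * n + 2 <= 3 * th * n] integers,
    and stays close to each one for at most [2 * w / th + 1 <= 3 * w / th] values of [u]. The
    hypotheses [1 <= th * INR n] and [th <= w] serve to absorb these additive constants, which
    leaves a bound proportional to [w]. *)
Lemma count_near_int n th w s :
  0 < th -> th <= w -> w <= / 2 -> 1 <= th * INR n ->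
  rsum n (fun u => indic (exists p : Z, Rabs (th * INR u + s - IZR p) < w))
  <= 9 * w * INR n.
Proof.
  intros Hth Hw Hw2 Hn.
  destruct (archimed (s - w)) as [h1 h2].
  (* [p0] is the least integer above [s - w], hence the first one that can be approached; the others
     are [p0 + k] with [k < th * n + 2 * w <= th * n + 1 < K]. *)
  set (p0 := up (s - w)) in *.
  destruct (nat_ceil (th * INR n + 1)) as [K [HK1 HK2]]; [lra|].
  set (Q := fun k u => Rabs (th * INR u + s - IZR (p0 + Z.of_nat k)) < w).
  apply Rle_trans with (rsum n (fun u => rsum K (fun k => indic (Q k u)))).
  { apply rsum_le; intros u Hu; apply indic_ex_le.
    intros [p Hp].
    assert (Hu' : 0 <= INR u < INR n) by (split; [apply pos_INR | now apply lt_INR]).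
    apply Rabs_def2 in Hp.
    assert (Hpp : (p0 <= p)%Z).
    { assert (IZR p0 < IZR (p + 1)) by (rewrite plus_IZR; nra).
      apply lt_IZR in H; lia. }
    exists (Z.to_nat (p - p0)); unfold Q; rewrite Z2Nat.id by lia.
    replace (p0 + (p - p0))%Z with p by lia.
    split; [|apply Rabs_def1; lra].
    apply INR_lt; rewrite INR_IZR_INZ, Z2Nat.id, minus_IZR by lia.
    nra. }
  rewrite rsum_exchange.
  apply Rle_trans with (rsum K (fun _ => 2 * w / th + 1)).
  { apply rsum_le; intros k _; apply (count_pairwise_close n (Q k)).
    - apply Rmult_le_pos; [lra | left; apply Rinv_0_lt_compat; lra].
    - intros u v hu hv; unfold Q in *.
      apply Rabs_def2 in hu; apply Rabs_def2 in hv.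
      apply Rmult_le_reg_l with th; [lra|].
      replace (th * (2 * w / th)) with (2 * w) by (field; lra); lra. }
  rewrite rsum_const.
  apply Rle_trans with (3 * (th * INR n) * (3 * w / th)).
  - apply Rmult_le_compat; try lra.
    + assert (0 <= 2 * w / th)
        by (apply Rmult_le_pos; [lra | left; apply Rinv_0_lt_compat; lra]); lra.
    + apply Rmult_le_reg_l with th; [lra|].
      replace (th * (2 * w / th + 1)) with (2 * w + th) by (field; lra).
      replace (th * (3 * w / th)) with (3 * w) by (field; lra); lra.
  - right; field; lra.
Qed.

(** * Trees of grid cells *)

(** The pair [(a, b)] at level [i] stands for the square of side [1 / G i] with lower left corner
    [(a / G i, b / G i)]. Each square splits into [M i] by [M i] squares of the next level, so
    integer division by [M i] yields the parent. *)
Fixpoint alive (M : nat -> nat) (bad : nat -> nat -> nat -> Prop)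
    (i a b : nat) : Prop :=
  match i with
  | O => True
  | S j => alive M bad j (a / M j) (b / M j) /\ ~ bad i a b
  end.

(** If every [c < n] failed at some [k], then, [F] being decreasing in [k], all would fail at the
    largest of these finitely many [k]. *)
Lemma finite_pigeonhole1 n (F : nat -> nat -> Prop) :
  (forall k c, F (S k) c -> F k c) ->
  (forall k, exists c, (c < n)%nat /\ F k c) ->
  exists c, forall k, F k c.
Proof.
  intros Hdec Hex.
  assert (Hmon : forall k m c, (k <= m)%nat -> F m c -> F k c)
    by (induction 1; auto).
  apply NNPP; intros Hno.
  assert (H : forall m, exists k, forall c, (c < m)%nat -> ~ F k c).
  { induction m as [|m [k1 H1]]; [exists O; intros; lia|].
    assert (exists k2, ~ F k2 m) as [k2 H2].
    { apply NNPP; intros H; apply Hno; exists m; intros k.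
      apply NNPP; intros H'; apply H; eauto. }
    exists (max k1 k2); intros c Hc HF.
    destruct (Nat.eq_dec c m) as [->|].
    - apply H2, (Hmon _ (max k1 k2)); [lia | assumption].
    - apply (H1 c); [lia|]; apply (Hmon _ (max k1 k2)); [lia | assumption]. }
  destruct (H n) as [k Hk]; destruct (Hex k) as (c & Hc & HF).
  exact (Hk c Hc HF).
Qed.

Lemma finite_pigeonhole n (F : nat -> nat -> nat -> Prop) :
  (forall k c d, F (S k) c d -> F k c d) ->
  (forall k, exists c d, ((c < n)%nat /\ (d < n)%nat) /\ F k c d) ->
  exists c d, forall k, F k c d.
Proof.
  intros Hdec Hex.
  destruct (finite_pigeonhole1 n (fun k c => exists d, (d < n)%nat /\ F k c d))
    as [c Hc].
  - intros k c (d & Hd & HF); eauto.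
  - intros k; destruct (Hex k) as (c & d & [Hc Hd] & HF); eauto.
  - destruct (finite_pigeonhole1 n (fun k d => F k c d)) as [d Hd]; eauto.
Qed.

Section Tree.

Variables (M G : nat -> nat) (bad : nat -> nat -> nat -> Prop).
Hypothesis M_pos : forall i, (0 < M i)%nat.
Hypothesis G_pos : forall i, (0 < G i)%nat.
Hypothesis G_succ : forall i, G (S i) = (G i * M i)%nat.

Definition alive_count (i : nat) : R :=
  sum2 (G i) (fun a b => indic (alive M bad i a b)).

Lemma div_block A k u : (u < k)%nat -> ((A * k + u) / k)%nat = A.
Proof. intros; symmetry; apply (Nat.div_unique _ k A u); lia. Qed.

Lemma alive_count_lift i :
  sum2 (G (S i)) (fun a b => indic (alive M bad i (a / M i) (b / M i)))
  = INR (M i) ^ 2 * alive_count i.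
Proof.
  rewrite G_succ, sum2_block; unfold alive_count; rewrite <- sum2_scal.
  apply sum2_ext; intros A B _ _.
  rewrite <- sum2_const; apply sum2_ext; intros u v Hu Hv.
  now rewrite !div_block.
Qed.

(* The Peres-Schlag step: the cells removed at level [i + 2] are counted inside
   the coarser set alive at level [i], where the removal is equidistributed. *)
Lemma alive_count_step i (P Q : nat -> nat -> Prop) d k :
  (forall a b, bad (S (S i)) a b -> P a b \/ Q a b) ->
  (forall A B, (A < G i)%nat -> (B < G i)%nat ->
     sum2 (M i * M (S i)) (fun u v =>
       indic (P (A * (M i * M (S i)) + u)%nat (B * (M i * M (S i)) + v)%nat))
     <= d * INR (M i * M (S i)) ^ 2) ->
  sum2 (G (S (S i))) (fun a b => indic (Q a b)) <= k * INR (G (S (S i))) ^ 2 ->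
  INR (M (S i)) ^ 2 * alive_count (S i)
    - d * INR (M i * M (S i)) ^ 2 * alive_count i - k * INR (G (S (S i))) ^ 2
  <= alive_count (S (S i)).
Proof.
  intros Hbad HP HQ.
  set (R2 := (M i * M (S i))%nat) in *.
  set (fP := fun a b => indic (alive M bad i (a / R2) (b / R2)) * indic (P a b)).
  assert (H1 : sum2 (G (S (S i)))
      (fun a b => indic (alive M bad (S i) (a / M (S i)) (b / M (S i))))
    <= sum2 (G (S (S i))) (fun a b => indic (alive M bad (S (S i)) a b)
         + (fP a b + indic (Q a b)))).
  { apply sum2_le; intros a b _ _; unfold fP.
    pose proof (indic_nonneg (alive M bad i (a / R2) (b / R2))).
    pose proof (indic_nonneg (P a b)).
    pose proof (indic_nonneg (Q a b)).
    pose proof (indic_nonneg (alive M bad (S (S i)) a b)).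
    assert (0 <= indic (alive M bad i (a / R2) (b / R2)) * indic (P a b))
      by (apply Rmult_le_pos; assumption).
    apply indic_le; [lra|]; intros Hal.
    destruct (classic (bad (S (S i)) a b)) as [hb|hb].
    - destruct (Hbad _ _ hb) as [hp|hq].
      + rewrite (indic_true _ hp), (indic_true (alive M bad i _ _)); [lra|].
        destruct Hal as [Hal _].
        rewrite !Nat.Div0.div_div in Hal.
        unfold R2; now rewrite (Nat.mul_comm (M i)).
      + rewrite (indic_true _ hq); lra.
    - rewrite (indic_true (alive M bad (S (S i)) a b)) by (split; assumption); lra. }
  rewrite !sum2_plus, alive_count_lift in H1.
  fold (alive_count (S (S i))) in H1.
  assert (H2 : sum2 (G (S (S i))) fP <= d * INR R2 ^ 2 * alive_count i).
  { replace (G (S (S i))) with (G i * R2)%nat by (unfold R2; rewrite !G_succ; lia).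
    rewrite sum2_block; unfold alive_count; rewrite <- sum2_scal.
    apply sum2_le; intros A B HA HB; unfold fP.
    rewrite (sum2_ext _ _ (fun u v => indic (alive M bad i A B) *
       indic (P (A * R2 + u)%nat (B * R2 + v)%nat)))
      by (intros; now rewrite !div_block).
    rewrite sum2_scal, Rmult_comm.
    apply Rmult_le_compat_r; [apply indic_nonneg | now apply HP]. }
  lra.
Qed.

Lemma alive_count_lower (P Q : nat -> nat -> nat -> Prop) :
  (forall a b, ~ bad 1 a b) ->
  (forall i a b, bad (S (S i)) a b -> P i a b \/ Q i a b) ->
  (forall i A B, (A < G i)%nat -> (B < G i)%nat ->
     sum2 (M i * M (S i)) (fun u v =>
       indic (P i (A * (M i * M (S i)) + u)%nat (B * (M i * M (S i)) + v)%nat))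
     <= / 8 * INR (M i * M (S i)) ^ 2) ->
  (forall i, sum2 (G (S (S i))) (fun a b => indic (Q i a b))
     <= (/ 4 * (/ 2) ^ S i) * INR (G (S (S i))) ^ 2) ->
  forall i, (/ 2) ^ i * INR (G i) ^ 2 <= alive_count i.
Proof.
  intros Hb1 Hbad HP HQ.
  assert (Hpos : forall i, 0 < INR (M i) /\ 0 < INR (G i))
    by (intros; split; apply lt_0_INR; auto).
  (* The second conjunct, that at least half of the children survive, strengthens the induction: the
     loss due to [P] is measured against level [i], and this conjunct converts it into a proportion
     of level [S i]. *)
  cut (forall i, (/ 2) ^ i * INR (G i) ^ 2 <= alive_count i /\
    INR (M i) ^ 2 * alive_count i <= 2 * alive_count (S i)).
  { intros H i; apply H. }
  assert (H0 : alive_count 0 = INR (G 0) ^ 2).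
  { unfold alive_count; rewrite <- (Rmult_1_r (INR (G 0) ^ 2)), <- sum2_const.
    apply sum2_ext; intros; now apply indic_true. }
  assert (H1 : alive_count 1 = INR (M 0) ^ 2 * alive_count 0).
  { rewrite <- alive_count_lift; unfold alive_count; apply sum2_ext; intros.
    rewrite !indic_true; simpl; auto. }
  assert (HG : forall i, INR (G (S i)) = INR (G i) * INR (M i))
    by (intros; rewrite G_succ, mult_INR; reflexivity).
  induction i as [|i [IH1 IH2]].
  - split; [rewrite H0; simpl; lra|].
    rewrite H1, H0.
    assert (0 <= INR (M 0) ^ 2 * INR (G 0) ^ 2)
      by (apply Rmult_le_pos; apply pow2_ge_0).
    lra.
  - destruct (Hpos i) as [Mi Gi].
    assert (L : (/ 2) ^ S i * INR (G (S i)) ^ 2 <= alive_count (S i)).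
    { rewrite HG.
      replace ((/ 2) ^ S i * (INR (G i) * INR (M i)) ^ 2)
        with (/ 2 * (INR (M i) ^ 2 * ((/ 2) ^ i * INR (G i) ^ 2)))
        by (simpl; ring).
      assert (INR (M i) ^ 2 * ((/ 2) ^ i * INR (G i) ^ 2)
        <= INR (M i) ^ 2 * alive_count i)
        by (apply Rmult_le_compat_l; [apply pow2_ge_0 | exact IH1]).
      lra. }
    split; [exact L|].
    pose proof (alive_count_step i (P i) (Q i) _ _ (Hbad i) (HP i) (HQ i)) as Hs.
    rewrite mult_INR, (HG (S i)) in Hs.
    (* Of the [INR (M (S i)) ^ 2 * alive_count (S i)] children, [P] removes a proportion of at most
       [2 * / 8] by [IH2], and [Q] at most [/ 4] by [L]; half remain. *)
    assert (E1 : INR (M (S i)) ^ 2 * ((/ 2) ^ S i * INR (G (S i)) ^ 2)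
      <= INR (M (S i)) ^ 2 * alive_count (S i))
      by (apply Rmult_le_compat_l; [apply pow2_ge_0 | exact L]).
    assert (E2 : INR (M (S i)) ^ 2 * (INR (M i) ^ 2 * alive_count i)
      <= INR (M (S i)) ^ 2 * (2 * alive_count (S i)))
      by (apply Rmult_le_compat_l; [apply pow2_ge_0 | exact IH2]).
    nra.
Qed.

(** * Infinite paths of alive cells *)

Lemma div_lt_parent i a : (a < G (S i))%nat -> (a / M i < G i)%nat.
Proof.
  intros H; apply Nat.Div0.div_lt_upper_bound; rewrite G_succ in H; lia.
Qed.

Fixpoint has_descendant (k i a b : nat) : Prop :=
  (a < G i)%nat /\ (b < G i)%nat /\ alive M bad i a b /\
  match k with
  | O => True
  | S m => exists c d, (c / M i)%nat = a /\ (d / M i)%nat = b /\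
      has_descendant m (S i) c d
  end.

Lemma has_descendant_self k i a b : has_descendant k i a b ->
  (a < G i)%nat /\ (b < G i)%nat /\ alive M bad i a b.
Proof. destruct k; simpl; tauto. Qed.

Lemma has_descendant_pred k i a b :
  has_descendant (S k) i a b -> has_descendant k i a b.
Proof.
  revert i a b; induction k as [|k IH]; intros i a b (Ha & Hb & Hal & H).
  - simpl; auto.
  - destruct H as (c & d & Hc & Hd & H).
    split; [|split; [|split]]; auto; exists c, d; auto.
Qed.

Lemma has_descendant_root k i a b : has_descendant k i a b ->
  exists a' b', has_descendant (k + i) 0 a' b'.
Proof.
  revert k a b; induction i as [|i IH]; intros k a b H.
  - rewrite Nat.add_0_r; eauto.
  - replace (k + S i)%nat with (S k + i)%nat by lia.
    destruct (has_descendant_self _ _ _ _ H) as (Ha & Hb & Hal & _).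
    apply (IH (S k) (a / M i)%nat (b / M i)%nat).
    split; [|split; [|split]]; auto using div_lt_parent.
    exists a, b; auto.
Qed.

(** König's lemma. A cell with alive descendants at every depth has a child with the same property,
    because it has finitely many children and depth is monotone; the path follows such cells by
    dependent choice. At the root the property comes from lifting an alive cell of each level to its
    ancestor. *)
Lemma konig_path :
  (forall i, 0 < alive_count i) ->
  exists a b : nat -> nat, forall i,
    (a (S i) / M i)%nat = a i /\ (b (S i) / M i)%nat = b i /\
    (a i < G i)%nat /\ (b i < G i)%nat /\ alive M bad i (a i) (b i).
Proof.
  intros Hpos.
  set (ext := fun i (c : nat * nat) =>
    forall k, has_descendant k i (fst c) (snd c)).
  assert (Hroot : exists c, ext O c).
  { destruct (finite_pigeonhole (G 0) (fun k c d => has_descendant k 0 c d))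
      as (a & b & H); [intros; now apply has_descendant_pred | |
        now exists (a, b)].
    intros k.
    assert (exists a b, has_descendant 0 k a b) as (a & b & H).
    { apply NNPP; intros Hno; apply (Rlt_irrefl 0).
      apply Rlt_le_trans with (1 := Hpos k); right.
      unfold alive_count; rewrite (sum2_ext _ _ (fun _ _ => 0)).
      - rewrite sum2_const; ring.
      - intros a b Ha Hb; apply indic_false; intros Hal; apply Hno.
        exists a, b; simpl; auto. }
    destruct (has_descendant_root _ _ _ _ H) as (a' & b' & H').
    exists a', b'; pose proof (has_descendant_self _ _ _ _ H'); simpl in H'.
    tauto. }
  assert (Hstep : forall i c, ext i c -> exists c', ext (S i) c' /\
    (fst c' / M i)%nat = fst c /\ (snd c' / M i)%nat = snd c).
  { intros i [a b] Hext.
    destruct (finite_pigeonhole (G (S i)) (fun k c d =>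
        (c / M i)%nat = a /\ (d / M i)%nat = b /\ has_descendant k (S i) c d))
      as (c & d & H).
    - intros k c d (? & ? & ?); auto using has_descendant_pred.
    - intros k; destruct (Hext (S k)) as (_ & _ & _ & c & d & Hc & Hd & H).
      pose proof (has_descendant_self _ _ _ _ H).
      exists c, d; simpl in *; tauto.
    - exists (c, d); split; [intros k; apply (H k)|]; split; apply (H O). }
  destruct Hroot as [c0 Hc0].
  set (next := fun i (c : {c | ext i c}) =>
    constructive_indefinite_description _ (Hstep i (proj1_sig c) (proj2_sig c))).
  set (path := fix path i : {c | ext i c} := match i with
    | O => exist _ c0 Hc0
    | S j => exist _ (proj1_sig (next j (path j)))
        (proj1 (proj2_sig (next j (path j)))) end).
  exists (fun i => fst (proj1_sig (path i))), (fun i => snd (proj1_sig (path i))).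
  intros i.
  pose proof (proj2 (proj2_sig (next i (path i)))) as [E1 E2].
  pose proof (has_descendant_self _ _ _ _ (proj2_sig (path i) O)).
  simpl; tauto.
Qed.

End Tree.

(** * Lines, covering sets and grids *)

Definition near_int (t w : R) : Prop := exists p : Z, Rabs (t - IZR p) < w.

Lemma dist_nint_ge t w : ~ near_int t w -> w <= dist_nint t.
Proof.
  intros H; unfold dist_nint.
  pose proof (Rplus_Int_part_frac_part t) as E.
  destruct (base_fp t) as [h1 h2].
  apply Rmin_glb; apply Rnot_lt_le; intros Hlt; apply H.
  - exists (Int_part t).
    replace (t - IZR (Int_part t)) with (frac_part t) by lra.
    apply Rabs_def1; lra.
  - exists (Int_part t + 1)%Z; rewrite plus_IZR.
    replace (t - (IZR (Int_part t) + 1)) with (frac_part t - 1) by lra.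
    apply Rabs_def1; lra.
Qed.

(** Along a row the values form an arithmetic progression of step [x / g]. The hypothesis
    [INR k <= x] says that its [n] terms advance by at least one unit, and [x <= w * INR g] that its
    step is at most [w], as [count_near_int] demands. *)
Lemma strip_count_row (x y w : R) (g n k A B v : nat) :
  0 < x -> (0 < n)%nat -> (g = k * n)%nat -> INR k <= x -> x <= w * INR g -> w <= / 2 ->
  rsum n (fun u => indic (near_int
    ((x * INR (A * n + u) + y * INR (B * n + v)) / INR g) w)) <= 9 * w * INR n.
Proof.
  intros Hx Hn Hg Hk Hxw Hw.
  assert (Hn0 : 0 < INR n) by now apply lt_0_INR.
  destruct (Nat.eq_dec k 0) as [->|Hk0].
  { simpl in Hg; subst g; simpl in Hxw; lra. }
  assert (Hk' : 0 < INR k) by (apply lt_0_INR; lia).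
  assert (Eg : INR g = INR k * INR n) by (rewrite Hg, mult_INR; reflexivity).
  assert (Hg0 : 0 < INR g) by nra.
  set (s := (x * INR (A * n) + y * INR (B * n + v)) / INR g).
  rewrite (rsum_ext n _ (fun u => indic (exists p : Z,
      Rabs (x / INR g * INR u + s - IZR p) < w))).
  - apply count_near_int; [now apply Rdiv_lt_0_compat | | exact Hw |].
    + apply Rmult_le_reg_r with (INR g); [lra|].
      replace (x / INR g * INR g) with x by (field; lra); lra.
    + rewrite Eg.
      replace (x / (INR k * INR n) * INR n) with (x / INR k) by (field; lra).
      apply Rmult_le_reg_r with (INR k); [lra|].
      replace (x / INR k * INR k) with x by (field; lra); lra.
  - intros u _; unfold near_int.
    replace ((x * INR (A * n + u) + y * INR (B * n + v)) / INR g)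
      with (x / INR g * INR u + s); [reflexivity|].
    unfold s; rewrite (plus_INR (A * n) u); field; lra.
Qed.

(** It suffices to count along the coordinate with the larger coefficient, uniformly in the other
    one; hence only the maximum of [x] and [y] has to be at least [k]. *)
Lemma strip_count (x y w : R) (g n k A B : nat) :
  0 < x -> 0 < y -> (0 < n)%nat -> (g = k * n)%nat -> INR k <= Rmax x y ->
  x <= w * INR g -> y <= w * INR g -> w <= / 2 ->
  sum2 n (fun u v => indic (near_int
    ((x * INR (A * n + u) + y * INR (B * n + v)) / INR g) w))
  <= 9 * w * INR n ^ 2.
Proof.
  intros Hx Hy Hn Hg Hk Hxw Hyw Hw.
  replace (9 * w * INR n ^ 2) with (INR n * (9 * w * INR n)) by ring.
  rewrite <- rsum_const.
  unfold Rmax in Hk; destruct (Rle_dec x y).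
  - apply rsum_le; intros u _.
    rewrite (rsum_ext n _ (fun v => indic (near_int
      ((y * INR (B * n + v) + x * INR (A * n + u)) / INR g) w)))
      by (intros; now rewrite (Rplus_comm (x * _))).
    apply (strip_count_row y x w g n k B A u); assumption.
  - rewrite sum2_swap; apply rsum_le; intros v _.
    apply (strip_count_row x y w g n k A B v); assumption.
Qed.

(** Cells are closed, since the limit point of nested cells may lie on their boundaries. *)
Definition cell_meets (g : nat) (U : R * R -> Prop) (a b : nat) : Prop :=
  exists p, U p /\ INR a <= fst p * INR g <= INR a + 1 /\
    INR b <= snd p * INR g <= INR b + 1.

Lemma dist2_fst p q : fst p - fst q <= dist2 p q.
Proof.
  unfold dist2; apply Rle_trans with (1 := Rle_abs _).
  rewrite <- sqrt_Rsqr_abs; apply sqrt_le_1_alt; unfold Rsqr.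
  pose proof (pow2_ge_0 (snd p - snd q)); simpl in *; lra.
Qed.

Lemma dist2_snd p q : snd p - snd q <= dist2 p q.
Proof.
  unfold dist2; apply Rle_trans with (1 := Rle_abs _).
  rewrite <- sqrt_Rsqr_abs; apply sqrt_le_1_alt; unfold Rsqr.
  pose proof (pow2_ge_0 (fst p - fst q)); simpl in *; lra.
Qed.

(** The cells that meet [U] lie in a product of columns and rows. Indices of two such columns differ
    by at most [r * g + 1], so there are at most [r * g + 2 <= 3 * r * g] of them, and likewise for
    rows. *)
Lemma cell_meets_count g U r :
  diam_le U r -> 1 <= r * INR g ->
  sum2 g (fun a b => indic (cell_meets g U a b)) <= 9 * r ^ 2 * INR g ^ 2.
Proof.
  intros HU Hr.
  assert (Hg : 0 <= INR g) by apply pos_INR.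
  set (Pa := fun a => exists b, cell_meets g U a b).
  set (Pb := fun b => exists a, cell_meets g U a b).
  apply Rle_trans with (sum2 g (fun a b => indic (Pa a) * indic (Pb b))).
  { apply sum2_le; intros a b _ _; apply indic_le.
    - apply Rmult_le_pos; apply indic_nonneg.
    - intros H; rewrite !indic_true; unfold Pa, Pb; eauto; lra. }
  rewrite sum2_prod.
  replace (9 * r ^ 2 * INR g ^ 2) with ((3 * (r * INR g)) * (3 * (r * INR g)))
    by ring.
  assert (Hpos : forall P : nat -> Prop, 0 <= rsum g (fun a => indic (P a)))
    by (intros; apply rsum_nonneg; intros; apply indic_nonneg).
  apply Rmult_le_compat; auto; apply Rle_trans with (r * INR g + 1 + 1); try lra;
    apply count_pairwise_close; try lra.
  - intros u v (b & p & Hp & Hpa & _) (b' & q & Hq & Hqa & _).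
    pose proof (HU p q Hp Hq); pose proof (dist2_fst p q); nra.
  - intros u v (b & p & Hp & _ & Hpa) (b' & q & Hq & _ & Hqa).
    pose proof (HU p q Hp Hq); pose proof (dist2_snd p q); nra.
Qed.

(** Nested intervals: the point is the supremum of the left endpoints, which every right endpoint
    bounds. *)
Lemma nested_cells_point (M G a : nat -> nat) :
  (forall i, (0 < M i)%nat) -> (forall i, (0 < G i)%nat) ->
  (forall i, G (S i) = (G i * M i)%nat) ->
  (forall i, (a (S i) / M i)%nat = a i) ->
  exists t, forall i, INR (a i) <= t * INR (G i) <= INR (a i) + 1.
Proof.
  intros HM HG HGS Ha.
  assert (HG' : forall i, 0 < INR (G i)) by (intros; apply lt_0_INR; auto).
  assert (HM' : forall i, 0 < INR (M i)) by (intros; apply lt_0_INR; auto).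
  set (lo := fun i => INR (a i) / INR (G i)).
  set (hi := fun i => (INR (a i) + 1) / INR (G i)).
  assert (Hstep : forall i, lo i <= lo (S i) /\ hi (S i) <= hi i).
  { intros i; unfold lo, hi; rewrite HGS, mult_INR.
    pose proof (Nat.div_mod (a (S i)) (M i)) as E.
    pose proof (Nat.mod_upper_bound (a (S i)) (M i)) as F.
    specialize (HM i); rewrite Ha in E.
    assert (E1 : INR (M i) * INR (a i) <= INR (a (S i)))
      by (rewrite <- mult_INR; apply le_INR; lia).
    assert (E2 : INR (a (S i)) + 1 <= INR (M i) * (INR (a i) + 1)).
    { rewrite <- !S_INR, <- mult_INR; apply le_INR; lia. }
    specialize (HG' i); specialize (HM' i).
    split; apply Rmult_le_reg_r with (INR (G i) * INR (M i)); try nra.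
    - replace (INR (a i) / INR (G i) * (INR (G i) * INR (M i)))
        with (INR (M i) * INR (a i)) by (field; lra).
      replace (INR (a (S i)) / (INR (G i) * INR (M i)) * (INR (G i) * INR (M i)))
        with (INR (a (S i))) by (field; lra). lra.
    - replace ((INR (a i) + 1) / INR (G i) * (INR (G i) * INR (M i)))
        with (INR (M i) * (INR (a i) + 1)) by (field; lra).
      replace ((INR (a (S i)) + 1) / (INR (G i) * INR (M i)) * (INR (G i) * INR (M i)))
        with (INR (a (S i)) + 1) by (field; lra). lra. }
  assert (Hlohi : forall i, lo i <= hi i).
  { intros i; unfold lo, hi; apply Rmult_le_compat_r; [|lra].
    left; apply Rinv_0_lt_compat; auto. }
  assert (Hmon : forall i k, lo i <= lo (i + k)%nat /\ hi (i + k)%nat <= hi i).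
  { intros i; induction k as [|k IH]; [rewrite Nat.add_0_r; lra|].
    rewrite Nat.add_succ_r; destruct (Hstep (i + k)%nat); lra. }
  assert (Hcross : forall i j, lo i <= hi j).
  { intros i j; pose proof (Hmon i j); pose proof (Hmon j i).
    rewrite (Nat.add_comm j i) in *; pose proof (Hlohi (i + j)%nat); lra. }
  destruct (completeness (fun z => exists i, z = lo i)) as [t [Hub Hlub]].
  - exists (hi O); intros z [i ->]; auto.
  - exists (lo O); eauto.
  - exists t; intros i.
    assert (H1 : lo i <= t) by (apply Hub; eauto).
    assert (H2 : t <= hi i) by (apply Hlub; intros z [j ->]; auto).
    unfold lo, hi in *; specialize (HG' i).
    split; apply Rmult_le_reg_r with (/ INR (G i)); try (apply Rinv_0_lt_compat; lra);
      rewrite Rmult_assoc, Rinv_r by lra; unfold Rdiv in *; lra.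
Qed.

(** * Estimates for the logarithm *)

Lemma ln_le_sub_1 z : 0 < z -> ln z <= z - 1.
Proof.
  intros Hz; pose proof (exp_ineq1_le (ln z)) as H.
  rewrite exp_ln in H; lra.
Qed.

(** The induction step is [1 / (n + 1) <= ln (n + 1) - ln n], which is [ln t <= t - 1] at
    [t = n / (n + 1)]. *)
Lemma harmonic_le n : (0 < n)%nat -> rsum n (fun k => / INR (S k)) <= 1 + ln (INR n).
Proof.
  induction 1 as [|n Hn IH].
  - simpl; rewrite ln_1; lra.
  - change (rsum n (fun k => / INR (S k)) + / INR (S n) <= 1 + ln (INR (S n))).
    assert (H0 : 0 < INR n) by (apply lt_0_INR; lia).
    assert (H1 : 0 < INR (S n)) by (apply lt_0_INR; lia).
    pose proof (ln_le_sub_1 (INR n / INR (S n)) (Rdiv_lt_0_compat _ _ H0 H1)) as H.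
    unfold Rdiv in H at 1; rewrite ln_mult, ln_Rinv in H;
      auto using Rinv_0_lt_compat.
    replace (INR n / INR (S n) - 1) with (- / INR (S n)) in H
      by (rewrite S_INR in *; field; lra).
    lra.
Qed.

Lemma ln_le x y : 0 < x -> x <= y -> ln x <= ln y.
Proof.
  intros Hx [H|<-]; [left; now apply ln_increasing | lra].
Qed.

(* From [ln z = 4 ln (z ^ (1/4)) < 4 z ^ (1/4)]. *)
Lemma ln_sq_le z : 1 <= z -> ln z ^ 2 <= 16 * sqrt z.
Proof.
  intros Hz.
  assert (H1 : 0 < sqrt z) by (apply sqrt_lt_R0; lra).
  assert (H2 : 0 < sqrt (sqrt z)) by now apply sqrt_lt_R0.
  set (q := sqrt (sqrt z)) in *.
  assert (E1 : q * q = sqrt z) by (apply sqrt_sqrt; lra).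
  assert (E2 : sqrt z * sqrt z = z) by (apply sqrt_sqrt; lra).
  assert (E : ln z = 4 * ln q).
  { rewrite <- E2, <- E1, !ln_mult by nra; ring. }
  assert (H0 : 0 <= ln z) by (rewrite <- ln_1; apply ln_le; lra).
  pose proof (ln_le_sub_1 q H2).
  rewrite <- E1; nra.
Qed.

(** * The removed strips *)

Definition c0 : R := / 20000.

(** Chosen so that [z * width z * ln z ^ 2 = c0]: a distance of at least [width (x y)] to the
    integers is the required inequality with [c = c0]. *)
Definition width (z : R) : R := c0 / (z * ln z ^ 2).

Fixpoint block (K i : nat) : nat :=
  match i with
  | O => K
  | S j => (block K j ^ 8)%nat
  end.

(** The exponent 3 is large enough for the cells to resolve all strips with [x y < block K i]
    ([grid_resolves_width]), and small enough, as [3 + 3 <= 8], for [grid K i ^ 2 <= block K (S i)]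
    ([grid_le_max]). The exponent of [ratio] is then [3 * 8 - 3 = 21]. *)
Definition grid (K i : nat) : nat := (block K i ^ 3)%nat.

Definition ratio (K i : nat) : nat := (block K i ^ 21)%nat.

(** Only the lower left corner of the cell is tested, but with twice the width: inside a cell the
    form varies by at most [(x + y) / g <= width], so a cell that passes the test has all its points
    at distance at least [width] ([strip_free_far]). *)
Definition strip (K i a b : nat) : Prop :=
  exists x y : nat, (0 < x)%nat /\ (0 < y)%nat /\
    (block K (S i) <= x * y < block K (S (S i)))%nat /\
    near_int ((INR x * INR a + INR y * INR b) / INR (grid K (S (S i))))
      (2 * width (INR x * INR y)).

Lemma block_succ K i : block K (S i) = (block K i ^ 8)%nat.
Proof. reflexivity. Qed.

Section Grid.

Variable K : nat.
(* [320000 = 16 / c0], so that [ln z ^ 2 <= 16 * sqrt z <= c0 * z] for [z >= K]. *)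
Hypothesis K_large : 320000 ^ 2 <= INR K.

Lemma K_ge_3 : (3 <= K)%nat.
Proof. apply INR_le; simpl (INR 3); lra. Qed.

Lemma block_ge_K i : (K <= block K i)%nat.
Proof.
  pose proof K_ge_3.
  induction i as [|i IH]; [simpl; lia | rewrite block_succ].
  apply Nat.le_trans with (1 := IH).
  rewrite <- (Nat.pow_1_r (block K i)) at 1; apply Nat.pow_le_mono_r; lia.
Qed.

Lemma block_pos i : (0 < block K i)%nat.
Proof. pose proof (block_ge_K i); pose proof K_ge_3; lia. Qed.

Lemma grid_pos i : (0 < grid K i)%nat.
Proof.
  pose proof (block_pos i); unfold grid.
  apply Nat.neq_0_lt_0, Nat.pow_nonzero; lia.
Qed.

Lemma ratio_pos i : (0 < ratio K i)%nat.
Proof.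
  pose proof (block_pos i); unfold ratio.
  apply Nat.neq_0_lt_0, Nat.pow_nonzero; lia.
Qed.

Lemma grid_succ i : grid K (S i) = (grid K i * ratio K i)%nat.
Proof.
  unfold grid, ratio; rewrite block_succ.
  rewrite <- Nat.pow_mul_r, <- Nat.pow_add_r; reflexivity.
Qed.

Lemma block_ge_pow i : (K ^ i <= block K i)%nat.
Proof.
  induction i as [|i IH]; [pose proof K_ge_3; simpl; lia|].
  rewrite block_succ, Nat.pow_succ_r'; pose proof (block_ge_K i).
  apply Nat.le_trans with (block K i ^ 2)%nat; [simpl; nia|].
  apply Nat.pow_le_mono_r; pose proof (block_pos i); lia.
Qed.

Lemma block_le_grid i : (block K i <= grid K i)%nat.
Proof.
  unfold grid; rewrite <- (Nat.pow_1_r (block K i)) at 1.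
  apply Nat.pow_le_mono_r; pose proof (block_pos i); lia.
Qed.

Lemma block_gt_index i : (i < block K i)%nat.
Proof.
  pose proof K_ge_3.
  induction i as [|i IH]; [simpl; lia | rewrite block_succ].
  pose proof (block_ge_K i).
  apply Nat.lt_le_trans with (block K i ^ 2)%nat.
  - simpl; nia.
  - apply Nat.pow_le_mono_r; lia.
Qed.

Lemma block_large i : 320000 ^ 2 <= INR (block K i).
Proof.
  apply Rle_trans with (1 := K_large); apply le_INR, block_ge_K.
Qed.

Lemma ln_ge_1 z : 3 <= z -> 1 <= ln z.
Proof.
  intros Hz; rewrite <- (ln_exp 1); apply ln_le; [apply exp_pos|].
  pose proof exp_le_3; lra.
Qed.

Lemma width_pos z : 3 <= z -> 0 < width z.
Proof.
  intros Hz; pose proof (ln_ge_1 z Hz); unfold width, c0.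
  apply Rdiv_lt_0_compat; [lra|].
  apply Rmult_lt_0_compat; [lra | apply pow_lt; lra].
Qed.

Lemma grid_resolves_width i (x y : nat) :
  (0 < x)%nat -> (0 < y)%nat -> (block K i <= x * y < block K (S i))%nat ->
  INR x + INR y <= width (INR x * INR y) * INR (grid K (S i)).
Proof.
  intros Hx Hy [H1 H2].
  (* For positive integers [x + y <= x y + 1]. *)
  assert (Hxy : (x + y <= block K (S i))%nat) by nia.
  apply le_INR in Hxy; rewrite plus_INR in Hxy.
  apply le_INR in H1; apply lt_INR in H2; rewrite mult_INR in H1, H2.
  pose proof (block_large i) as HL; pose proof (block_large (S i)) as HL2.
  unfold grid; rewrite pow_INR.
  set (b := INR (block K (S i))) in *; set (z := INR x * INR y) in *.
  assert (Hz : 3 <= z) by lra.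
  pose proof (ln_ge_1 z Hz) as Hln.
  (* With this, [z * ln z ^ 2 <= c0 * b ^ 2], hence [width z * b ^ 3 >= b >= x + y]. *)
  assert (Hlnb : ln z ^ 2 <= c0 * b).
  { apply Rle_trans with (ln b ^ 2).
    - apply pow_incr; split; [lra | apply ln_le; lra].
    - apply Rle_trans with (1 := ln_sq_le b ltac:(lra)).
      assert (E : sqrt b * sqrt b = b) by (apply sqrt_sqrt; lra).
      assert (320000 <= sqrt b).
      { rewrite <- (sqrt_pow2 320000) by lra; apply sqrt_le_1_alt; exact HL2. }
      rewrite <- E at 2; unfold c0; nra. }
  assert (Hz2 : 0 < z * ln z ^ 2)
    by (apply Rmult_lt_0_compat; [lra | apply pow_lt; lra]).
  apply Rle_trans with (1 := Hxy).
  unfold width; apply Rmult_le_reg_r with (z * ln z ^ 2); [exact Hz2|].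
  replace (c0 / (z * ln z ^ 2) * b ^ 3 * (z * ln z ^ 2)) with (c0 * b ^ 3)
    by (field; split; lra).
  apply Rle_trans with (b * (b * (c0 * b))); [|right; ring].
  apply Rmult_le_compat_l; [lra|].
  apply Rmult_le_compat; try lra; apply pow_le; lra.
Qed.

(** The source of equidistribution: along one of the sides of a square of level [i], which have
    length [1 / grid K i], the form [x alpha + y beta] varies by at least 1. *)
Lemma grid_le_max i (x y : nat) :
  (block K (S i) <= x * y)%nat -> INR (grid K i) <= Rmax (INR x) (INR y).
Proof.
  intros H; apply Rnot_lt_le; intros Hlt.
  assert (Hx : (x < grid K i)%nat)
    by (apply INR_lt; apply Rle_lt_trans with (2 := Hlt), Rmax_l).
  assert (Hy : (y < grid K i)%nat)
    by (apply INR_lt; apply Rle_lt_trans with (2 := Hlt), Rmax_r).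
  assert (x * y < grid K i * grid K i)%nat by nia.
  assert (grid K i * grid K i <= block K (S i))%nat; [|lia].
  unfold grid; rewrite <- Nat.pow_add_r; rewrite block_succ.
  apply Nat.pow_le_mono_r; pose proof (block_pos i); lia.
Qed.

(* [18 * c0 * 81 <= 1/8]: the harmonic sums contribute [(1 + 8 L)^2 <= 81 L^2]
   with [L = ln (block K (S i))], which the factor [1 / L^2] of the width absorbs. *)
Lemma strip_density i A B :
  let n := (ratio K i * ratio K (S i))%nat in
  sum2 n (fun u v => indic (strip K i (A * n + u) (B * n + v)))
  <= / 8 * INR n ^ 2.
Proof.
  intros n.
  assert (Hn : (0 < n)%nat)
    by (pose proof (ratio_pos i); pose proof (ratio_pos (S i)); unfold n; nia).
  assert (Hg : grid K (S (S i)) = (grid K i * n)%nat)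
    by (unfold n; rewrite !grid_succ; lia).
  pose proof (block_large (S i)) as HL.
  set (N := block K (S (S i))).
  set (b := INR (block K (S i))) in *.
  set (L := ln b).
  assert (HL1 : 1 <= L) by (apply ln_ge_1; lra).
  (* Indices are shifted by one because [rsum] starts at [0] while the coefficients are positive;
     both are at most [x y < N], so sums up to [N] reach all of them. *)
  set (Q := fun x y u v : nat =>
    (block K (S i) <= S x * S y < N)%nat /\
    near_int ((INR (S x) * INR (A * n + u) + INR (S y) * INR (B * n + v))
      / INR (grid K (S (S i)))) (2 * width (INR (S x) * INR (S y)))).
  apply Rle_trans with (sum2 n (fun u v =>
    rsum N (fun x => rsum N (fun y => indic (Q x y u v))))).
  { apply sum2_le; intros u v _ _.
    apply Rle_trans with
      (rsum N (fun x => indic (exists y, (y < N)%nat /\ Q x y u v))).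
    - apply indic_ex_le; intros (x & y & Hx & Hy & Hb & Hnear).
      destruct x as [|x]; [lia|]; destruct y as [|y]; [lia|].
      exists x; split; [unfold N; nia|]; exists y; split; [unfold N; nia|].
      split; assumption.
    - apply rsum_le; intros x _; apply indic_ex_le; auto. }
  rewrite sum2_rsum.
  apply Rle_trans with (sum2 N (fun x y =>
    18 * c0 / L ^ 2 * INR n ^ 2 * (/ INR (S x) * / INR (S y)))).
  { apply rsum_le; intros x _; rewrite sum2_rsum; apply rsum_le; intros y _.
    assert (Hx : 1 <= INR (S x)) by (apply (le_INR 1); lia).
    assert (Hy : 1 <= INR (S y)) by (apply (le_INR 1); lia).
    assert (HL2 : 0 < L ^ 2) by (apply pow_lt; lra).
    destruct (classic (block K (S i) <= S x * S y < N)%nat) as [Hb|Hb].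
    - assert (Hz : b <= INR (S x) * INR (S y))
        by (rewrite <- mult_INR; apply le_INR; lia).
      set (z := INR (S x) * INR (S y)) in *.
      assert (Hlnz : L <= ln z) by (apply ln_le; lra).
      assert (Hw : 0 < width z) by (apply width_pos; lra).
      assert (Hw' : width z <= c0 / (z * L ^ 2)).
      { unfold width, Rdiv; apply Rmult_le_compat_l; [unfold c0; lra|].
        apply Rinv_le_contravar.
        - apply Rmult_lt_0_compat; lra.
        - apply Rmult_le_compat_l; [lra|]; apply pow_incr; lra. }
      assert (Hw2 : width z <= c0).
      { apply Rle_trans with (1 := Hw'); rewrite <- (Rmult_1_r c0) at 2.
        unfold Rdiv; apply Rmult_le_compat_l; [unfold c0; lra|].
        rewrite <- Rinv_1; apply Rinv_le_contravar; [lra|].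
        assert (1 <= L ^ 2) by (apply pow_R1_Rle; exact HL1); nra. }
      pose proof (grid_resolves_width (S i) (S x) (S y)
        ltac:(lia) ltac:(lia) Hb) as Hres.
      fold z in Hres.
      assert (Hg0 : 0 <= INR (grid K (S (S i)))) by apply pos_INR.
      apply Rle_trans with (9 * (2 * width z) * INR n ^ 2).
      + apply Rle_trans with (sum2 n (fun u v => indic (near_int
          ((INR (S x) * INR (A * n + u) + INR (S y) * INR (B * n + v))
           / INR (grid K (S (S i)))) (2 * width z)))).
        * apply sum2_le; intros u v _ _; apply indic_le; [apply indic_nonneg|].
          intros [_ H]; rewrite indic_true; [lra | exact H].
        * apply strip_count with (k := grid K i);
            try lra; try assumption; try nra.
          -- apply grid_le_max; lia.
          -- unfold c0 in Hw2; lra.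
      + replace (18 * c0 / L ^ 2 * INR n ^ 2 * (/ INR (S x) * / INR (S y)))
          with (9 * (2 * (c0 / (z * L ^ 2))) * INR n ^ 2)
          by (unfold z; field; repeat split; lra).
        apply Rmult_le_compat_r; [apply pow2_ge_0 | lra].
    - rewrite (sum2_ext _ _ (fun _ _ => 0)).
      + rewrite sum2_const, Rmult_0_r.
        apply Rmult_le_pos; [apply Rmult_le_pos; [|apply pow2_ge_0]|].
        * apply Rmult_le_pos; [unfold c0; lra | left; now apply Rinv_0_lt_compat].
        * apply Rmult_le_pos; left; apply Rinv_0_lt_compat; lra.
      + intros u v _ _; apply indic_false; intros [H _]; tauto. }
  rewrite sum2_scal, sum2_prod.
  assert (HN : (0 < N)%nat) by apply block_pos.
  pose proof (harmonic_le N HN) as HH.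
  assert (EN : ln (INR N) = 8 * L).
  { unfold N; rewrite block_succ, pow_INR, ln_pow by (fold b; lra).
    fold b L; simpl INR; ring. }
  rewrite EN in HH.
  set (h := rsum N (fun k => / INR (S k))) in *.
  assert (Hh0 : 0 <= h).
  { apply rsum_nonneg; intros k _; left; apply Rinv_0_lt_compat, lt_0_INR; lia. }
  assert (Hh : h * h <= 81 * L ^ 2) by nra.
  apply Rle_trans with (18 * c0 / L ^ 2 * INR n ^ 2 * (81 * L ^ 2)).
  - apply Rmult_le_compat_l; [|exact Hh].
    apply Rmult_le_pos; [|apply pow2_ge_0].
    apply Rmult_le_pos; [unfold c0; lra|].
    left; apply Rinv_0_lt_compat, pow_lt; lra.
  - replace (18 * c0 / L ^ 2 * INR n ^ 2 * (81 * L ^ 2))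
      with (18 * c0 * 81 * INR n ^ 2) by (field; lra).
    apply Rmult_le_compat_r; [apply pow2_ge_0 | unfold c0; lra].
Qed.

Lemma strip_free_far i (x y a b : nat) (t u : R) :
  (0 < x)%nat -> (0 < y)%nat ->
  (block K (S i) <= x * y < block K (S (S i)))%nat -> ~ strip K i a b ->
  INR a <= t * INR (grid K (S (S i))) <= INR a + 1 ->
  INR b <= u * INR (grid K (S (S i))) <= INR b + 1 ->
  width (INR x * INR y) <= dist_nint (INR x * t + INR y * u).
Proof.
  intros Hx Hy Hb Hns Ht Hu; apply dist_nint_ge; intros [p Hp].
  apply Hns; exists x, y; repeat split; try assumption; try lia.
  pose proof (grid_resolves_width (S i) x y Hx Hy Hb) as Hres.
  assert (Hg : 0 < INR (grid K (S (S i)))) by (apply lt_0_INR, grid_pos).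
  set (g := INR (grid K (S (S i)))) in *; set (w := width _) in *.
  assert (Hx' : 0 < INR x) by now apply lt_0_INR.
  assert (Hy' : 0 < INR y) by now apply lt_0_INR.
  exists p; apply Rabs_def2 in Hp.
  set (d := (INR x * INR a + INR y * INR b) / g).
  assert (E : d * g = INR x * INR a + INR y * INR b) by (unfold d; field; lra).
  assert (H1 : (INR x * t + INR y * u - w) * g <= d * g).
  { rewrite E; nra. }
  assert (H2 : d * g <= (INR x * t + INR y * u) * g) by (rewrite E; nra).
  apply Rmult_le_reg_r in H1, H2; try assumption.
  apply Rabs_def1; lra.
Qed.

End Grid.

(** * The lower bound *)

Lemma Rpower_pos x y : 0 < Rpower x y.
Proof. apply exp_pos. Qed.

Lemma rsum_sum_f_R0 n f : rsum (S n) f = sum_f_R0 f n.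
Proof.
  induction n as [|n IH]; [simpl; lra|].
  change (rsum (S n) f + f (S n) = sum_f_R0 f n + f (S n)); now rewrite IH.
Qed.

Lemma rsum_le_infinite_sum f l n :
  (forall k, 0 <= f k) -> infinite_sum f l -> rsum n f <= l.
Proof.
  intros Hf Hl; apply Rnot_lt_le; intros Hlt.
  destruct (Hl (rsum n f - l)) as [N HN]; [lra|].
  specialize (HN (max n N) ltac:(lia)).
  rewrite <- rsum_sum_f_R0 in HN; unfold Rdist in HN; apply Rabs_def2 in HN.
  pose proof (rsum_le_index n (S (max n N)) f Hf ltac:(lia)); lra.
Qed.

Lemma infinite_sum_term_small f l e :
  infinite_sum f l -> 0 < e -> exists N, forall n, (N <= n)%nat -> f n < e.
Proof.
  intros Hl He; destruct (Hl (e / 2)) as [N HN]; [lra|].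
  exists (S N); intros n Hn; destruct n as [|n]; [lia|].
  pose proof (HN n ltac:(lia)) as H1; pose proof (HN (S n) ltac:(lia)) as H2.
  simpl in H2; unfold Rdist in *; apply Rabs_def2 in H1, H2; lra.
Qed.

Lemma Rpower_lt_inv x y s :
  0 <= s -> 0 < x -> 0 < y -> Rpower x s < Rpower y s -> x < y.
Proof.
  intros Hs Hx Hy H; apply Rnot_le_lt; intros Hle.
  pose proof (Rle_Rpower_l y x s Hs (conj Hy Hle)); lra.
Qed.

(** Since [rho < 1 / grid K i <= K ^ (-i)], the power is at most [(K ^ sg) ^ (-i)], and
    [K ^ sg >= 2]. With [sg = 2 - s] this makes the area lost to covering sets comparable to the
    proportion [2 ^ (-i)] that survives. *)
Lemma Rpower_grid_small K i rho sg :
  320000 ^ 2 <= INR K -> 0 < sg -> 2 <= Rpower (INR K) sg -> 0 < rho ->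
  rho * INR (grid K i) < 1 -> Rpower rho sg <= (/ 2) ^ i.
Proof.
  intros HK Hsg HK2 Hrho Hlt.
  assert (HK0 : 0 < INR K) by lra.
  assert (Hp : 0 < INR K ^ i) by now apply pow_lt.
  assert (Hle : INR K ^ i <= INR (grid K i)).
  { rewrite <- pow_INR; apply le_INR.
    apply Nat.le_trans with (1 := block_ge_pow K HK i), block_le_grid, HK. }
  apply Rmult_le_reg_r with (Rpower (INR K ^ i) sg); [apply Rpower_pos|].
  rewrite Rpower_mult_distr by assumption.
  apply Rle_trans with (Rpower 1 sg).
  - apply Rle_Rpower_l; [lra|]; split; [now apply Rmult_lt_0_compat | nra].
  - rewrite <- (Rpower_pow i (INR K)) by assumption.
    rewrite Rpower_mult, (Rmult_comm (INR i)), <- Rpower_mult.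
    rewrite Rpower_pow by apply Rpower_pos.
    unfold Rpower at 1; rewrite ln_1, Rmult_0_r, exp_0.
    rewrite <- Rpow_mult_distr; apply pow_R1_Rle; lra.
Qed.

Lemma last_index_before_failure (Phi : nat -> Prop) :
  Phi O -> ~ (forall i, Phi i) -> exists i, Phi i /\ ~ Phi (S i).
Proof.
  intros H0 Hn; apply NNPP; intros Hno; apply Hn; induction i as [|i IH]; [exact H0|].
  apply NNPP; intros H; apply Hno; eauto.
Qed.

Section LowerBound.

Variables (s : R) (K : nat) (U : nat -> R * R -> Prop) (r : nat -> R) (l : R).
Hypothesis s_range : 0 <= s < 2.
Hypothesis K_large : 320000 ^ 2 <= INR K.
Hypothesis K_large_s : 2 <= Rpower (INR K) (2 - s).
Hypothesis U_diam : forall n, 0 < r n /\ diam_le (U n) (r n).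
Hypothesis r_sum : infinite_sum (fun n => Rpower (r n) s) l.
Hypothesis l_small : l <= / 36.

(** Each [U n] is treated at one level at most, the first whose mesh does not exceed [r n]; there
    the cells that meet it number [O((r n * g) ^ 2)]. *)
Definition cover (i a b : nat) : Prop :=
  exists n, 1 <= r n * INR (grid K (S (S i))) /\ r n * INR (grid K (S i)) < 1 /\
    cell_meets (grid K (S (S i))) (U n) a b.

(** Each set takes a proportion of at most [9 * r ^ 2 = 9 * r ^ s * r ^ (2 - s)], where
    [r ^ (2 - s) <= 2 ^ (-(i + 1))] by [Rpower_grid_small] and the [r ^ s] add up to at most [/ 36];
    and [9 / 36 = / 4]. *)
Lemma cover_density i :
  sum2 (grid K (S (S i))) (fun a b => indic (cover i a b))
  <= / 4 * (/ 2) ^ S i * INR (grid K (S (S i))) ^ 2.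
Proof.
  set (g := grid K (S (S i))).
  assert (Hg : 0 < INR g) by (apply lt_0_INR, grid_pos; assumption).
  (* The terms of the series tend to 0, so [r n < / INR g] for [n >= N], and only finitely many sets
     are treated at this level. *)
  destruct (infinite_sum_term_small _ _ (Rpower (/ INR g) s) r_sum (Rpower_pos _ _))
    as [N HN].
  set (Q := fun n a b => 1 <= r n * INR g /\ r n * INR (grid K (S i)) < 1 /\
    cell_meets g (U n) a b).
  apply Rle_trans with (sum2 g (fun a b => rsum N (fun n => indic (Q n a b)))).
  { apply sum2_le; intros a b _ _; apply indic_ex_le; intros (n & H1 & H2 & H3).
    exists n; split; [|repeat split; assumption].
    apply Nat.nle_gt; intros Hn; specialize (HN n Hn).
    apply Rpower_lt_inv in HN; [| lra | apply U_diam | now apply Rinv_0_lt_compat].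
    apply (Rmult_lt_compat_r (INR g)) in HN; [|assumption].
    rewrite Rinv_l in HN by lra; unfold g in HN; lra. }
  rewrite sum2_rsum.
  apply Rle_trans with
    (rsum N (fun n => 9 * (/ 2) ^ S i * INR g ^ 2 * Rpower (r n) s)).
  { apply rsum_le; intros n _; destruct (U_diam n) as [Hr Hd].
    assert (H2 : 0 < (/ 2) ^ S i) by (apply pow_lt; lra).
    pose proof (Rpower_pos (r n) s) as Hrs.
    destruct (classic (1 <= r n * INR g /\ r n * INR (grid K (S i)) < 1))
      as [[H3 H4]|H3].
    - apply Rle_trans with (9 * r n ^ 2 * INR g ^ 2).
      + apply Rle_trans with (2 := cell_meets_count g (U n) (r n) Hd H3).
        apply sum2_le; intros a b _ _; apply indic_le; [apply indic_nonneg|].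
        intros (_ & _ & H); rewrite indic_true; [lra | exact H].
      + assert (E : r n ^ 2 = Rpower (r n) s * Rpower (r n) (2 - s)).
        { rewrite <- Rpower_plus, <- (Rpower_pow 2) by assumption.
          f_equal; simpl; ring. }
        rewrite E.
        pose proof (Rpower_grid_small K (S i) (r n) (2 - s) K_large
          ltac:(lra) K_large_s Hr H4) as H5.
        apply Rle_trans with (9 * (Rpower (r n) s * (/ 2) ^ S i) * INR g ^ 2);
          [|right; ring].
        apply Rmult_le_compat_r; [apply pow2_ge_0|].
        apply Rmult_le_compat_l; [lra|].
        apply Rmult_le_compat_l; [lra | exact H5].
    - rewrite (sum2_ext _ _ (fun _ _ => 0)).
      + rewrite sum2_const, Rmult_0_r.
        apply Rmult_le_pos; [apply Rmult_le_pos; [lra | apply pow2_ge_0] | lra].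
      + intros a b _ _; apply indic_false; unfold Q; tauto. }
  rewrite rsum_scal.
  pose proof (rsum_le_infinite_sum _ _ N
    (fun n => Rlt_le _ _ (Rpower_pos (r n) s)) r_sum) as Hl.
  apply Rle_trans with (9 * (/ 2) ^ S i * INR g ^ 2 * / 36); [|right; field].
  apply Rmult_le_compat_l; [|lra].
  apply Rmult_le_pos; [|apply pow2_ge_0].
  apply Rmult_le_pos; [lra | apply pow_le; lra].
Qed.

Definition removed (i a b : nat) : Prop :=
  match i with
  | S (S j) => strip K j a b \/ cover j a b
  | _ => False
  end.

Lemma surviving_point :
  exists p : R * R, forall i, exists a b : nat,
    INR a <= fst p * INR (grid K (S (S i))) <= INR a + 1 /\
    INR b <= snd p * INR (grid K (S (S i))) <= INR b + 1 /\
    ~ strip K i a b /\ ~ cover i a b.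
Proof.
  pose proof (ratio_pos K K_large) as HM; pose proof (grid_pos K K_large) as HG.
  destruct (konig_path (ratio K) (grid K) removed (grid_succ K))
    as (a & b & Hab).
  { intros i.
    apply Rlt_le_trans with ((/ 2) ^ i * INR (grid K i) ^ 2).
    - apply Rmult_lt_0_compat; apply pow_lt; [lra | apply lt_0_INR, HG].
    - apply (alive_count_lower (ratio K) (grid K) removed HM HG (grid_succ K)
        (strip K) cover).
      + intros ? ? [].
      + intros ? ? ? H; exact H.
      + intros; apply strip_density; assumption.
      + apply cover_density. }
  destruct (nested_cells_point (ratio K) (grid K) a HM HG (grid_succ K)) as [t Ht];
    [intros i; apply Hab|].
  destruct (nested_cells_point (ratio K) (grid K) b HM HG (grid_succ K)) as [u Hu];
    [intros i; apply Hab|].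
  exists (t, u); intros i; exists (a (S (S i))), (b (S (S i))).
  destruct (Hab (S (S i))) as (_ & _ & _ & _ & Hal).
  split; [apply Ht|]; split; [apply Hu|].
  simpl in Hal; tauto.
Qed.

Lemma grid_unbounded t : exists i, t < INR (grid K i).
Proof.
  destruct (nat_ceil (Rmax 0 t) (Rmax_l _ _)) as [m [Hm _]]; exists m.
  pose proof (Rmax_r 0 t).
  apply Rle_lt_trans with (1 := H), Rlt_le_trans with (1 := Hm).
  pose proof (block_gt_index K K_large m).
  pose proof (block_le_grid K K_large m); apply le_INR; lia.
Qed.

Lemma uncovered_badly_approx :
  (forall n, r n * INR (grid K 1) < 1) ->
  exists p, badly_approx_set p /\ forall n, ~ U n p.
Proof.
  intros Hr1; destruct surviving_point as [p Hp].
  exists p; split.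
  (* The strips start with [strip K 0], that is, with products [x y >= block K 1]. *)
  - exists c0, (Z.of_nat (block K 1)); split; [unfold c0; lra|].
    intros x y Hx Hy HN M.
    rewrite <- INR_IZR_INZ, <- mult_INR in HN; apply INR_le in HN.
    destruct (last_index_before_failure (fun i => (block K (S i) <= x * y)%nat))
      as (i & Hi1 & Hi2); [exact HN | |].
    { intros H; specialize (H (x * y)%nat).
      pose proof (block_gt_index K K_large (S (x * y))); lia. }
    apply Nat.nle_gt in Hi2.
    destruct (Hp i) as (a & b & Ha & Hb & Hs & _).
    pose proof (strip_free_far K K_large i x y a b (fst p) (snd p) Hx Hy
      (conj Hi1 Hi2) Hs Ha Hb) as Hfar.
    assert (Hxy : 3 <= INR x * INR y).
    { rewrite <- mult_INR; apply Rle_trans with (INR K).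
      - simpl in K_large; lra.
      - apply le_INR, Nat.le_trans with (2 := Hi1), block_ge_K; assumption. }
    assert (EM : M = INR x * INR y) by (apply Rmax_right; lra).
    rewrite EM; set (z := INR x * INR y) in *.
    pose proof (ln_ge_1 z Hxy) as Hln.
    apply Rle_ge; apply Rle_trans with (z * width z * ln z ^ 2).
    + right; unfold width; field; split; lra.
    + apply Rmult_le_compat_r; [apply pow2_ge_0|].
      apply Rmult_le_compat_l; [lra | exact Hfar].
  - intros n Hn; destruct (U_diam n) as [Hr _].
    (* This finds the level at which [U n] was removed; the assumption on [grid K 1] ensures that no
       set is too large to have one. *)
    destruct (last_index_before_failure (fun i => r n * INR (grid K (S i)) < 1))
      as (i & Hi1 & Hi2); [apply Hr1 | |].
    { intros H; destruct (grid_unbounded (/ r n)) as [i Hi].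
      assert (INR (grid K i) <= INR (grid K (S i))).
      { apply le_INR; rewrite grid_succ; pose proof (ratio_pos K K_large i); nia. }
      specialize (H i).
      apply (Rmult_lt_compat_l (r n)) in Hi; [|assumption].
      rewrite Rinv_r in Hi by lra; nra. }
    destruct (Hp i) as (a & b & Ha & Hb & _ & Hc).
    apply Hc; exists n; repeat split; [lra | assumption |].
    exists p; auto.
Qed.

End LowerBound.

Lemma badly_approx_not_null s :
  0 <= s < 2 -> ~ hausdorff_null s badly_approx_set.
Proof.
  intros Hs Hnull.
  assert (exists K : nat, 320000 ^ 2 <= INR K /\ 2 <= Rpower (INR K) (2 - s))
    as (K & HK1 & HK2).
  (* The second entry gives [K ^ (2 - s) >= 2]. *)
  { set (T := Rmax (320000 ^ 2) (Rpower 2 (/ (2 - s)))).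
    assert (HT1 := Rmax_l (320000 ^ 2) (Rpower 2 (/ (2 - s)))).
    assert (HT2 := Rmax_r (320000 ^ 2) (Rpower 2 (/ (2 - s)))).
    fold T in HT1, HT2.
    destruct (nat_ceil T) as [K [HK _]]; [lra|].
    exists K; split; [lra|].
    apply Rle_trans with (Rpower (Rpower 2 (/ (2 - s))) (2 - s)).
    - rewrite Rpower_mult, Rinv_l, Rpower_1 by lra; lra.
    - apply Rle_Rpower_l; [lra|]; split; [apply Rpower_pos | lra]. }
  assert (Hg : 0 < INR (grid K 1)) by (apply lt_0_INR, grid_pos; assumption).
  (* A sum below [e] bounds each of its terms, which forces every [r n] below [/ INR (grid K 1)];
     the other bound, [/ 36], is the one for [cover_density]. *)
  set (e := Rpower (/ INR (grid K 1)) s).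
  destruct (Hnull (Rmin (/ 36) e)) as (U & r & l & Hcov & Hd & Hsum & Hl).
  { apply Rmin_glb_lt; [lra | apply Rpower_pos]. }
  pose proof (Rmin_l (/ 36) e); pose proof (Rmin_r (/ 36) e).
  destruct (uncovered_badly_approx s K U r l Hs HK1 HK2 Hd Hsum) as (p & Hp & Hno).
  - lra.
  - intros n.
    assert (Hn : Rpower (r n) s <= l).
    { apply Rle_trans with (rsum (S n) (fun k => Rpower (r k) s)).
      - apply (rsum_ge_term (S n) (fun k => Rpower (r k) s)); [|lia].
        intros; left; apply Rpower_pos.
      - apply rsum_le_infinite_sum; [|exact Hsum].
        intros; left; apply Rpower_pos. }
    assert (r n < / INR (grid K 1)) as Hlt.
    { apply Rpower_lt_inv with s; [lra | apply Hd | now apply Rinv_0_lt_compat |].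
      fold e; lra. }
    apply (Rmult_lt_compat_r (INR (grid K 1))) in Hlt; [|assumption].
    rewrite Rinv_l in Hlt by lra; exact Hlt.
  - destruct (Hcov p Hp) as [n Hn]; exact (Hno n Hn).
Qed.

(** * The upper bound *)

Lemma infinite_sum_bounded f D :
  (forall n, 0 <= f n) -> (forall n, rsum n f <= D) ->
  exists l, infinite_sum f l /\ l <= D.
Proof.
  intros Hf HD.
  destruct (growing_cv (sum_f_R0 f)) as [l Hl].
  - intros n; simpl; specialize (Hf (S n)); lra.
  - exists D; intros z [n ->]; rewrite <- rsum_sum_f_R0; apply HD.
  - exists l; split; [exact Hl|].
    apply Rnot_lt_le; intros Hlt.
    destruct (Hl (l - D)) as [N HN]; [lra|].
    specialize (HN N (Nat.le_refl N)); unfold Rdist in HN; apply Rabs_def2 in HN.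
    specialize (HD (S N)); rewrite rsum_sum_f_R0 in HD; lra.
Qed.

(** Passing from [k] to [2 k] or [2 k + 1] multiplies the weight by [q] for [k > 0], so a sum of
    doubled length is at most [2 + 2 * q] times the original sum, and the bound is the fixed point
    of this recursion. The 2 accounts for [k = 0] and [k = 1], as [Nat.log2 0 = 0]. *)
Lemma log2_weights_bounded q n :
  0 < q < / 2 -> rsum n (fun k => q ^ Nat.log2 k) <= 2 / (1 - 2 * q).
Proof.
  intros Hq; set (v := fun k => q ^ Nat.log2 k).
  assert (Hv : forall k, 0 <= v k) by (intros; apply pow_le; lra).
  assert (Hd : forall m, rsum (m * 2) v <= 2 + 2 * q * rsum m v).
  { intros m; rewrite rsum_block.
    destruct m as [|m]; [simpl; lra|].
    rewrite !rsum_first.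
    assert (E : rsum m (fun k => rsum 2 (fun u => v (S k * 2 + u)%nat))
      = 2 * q * rsum m (fun k => v (S k))).
    { rewrite <- rsum_scal; apply rsum_ext; intros k _.
      change (0 + v (S k * 2 + 0)%nat + v (S k * 2 + 1)%nat = 2 * q * v (S k)).
      unfold v.
      rewrite Nat.add_0_r, (Nat.mul_comm (S k) 2), Nat.log2_double,
        Nat.log2_succ_double by lia.
      simpl (q ^ S _); ring. }
    rewrite E; simpl rsum; unfold v; simpl; nra. }
  assert (Hpow : forall j, rsum (2 ^ j) v <= 2 / (1 - 2 * q)).
  { induction j as [|j IH].
    - simpl; unfold v; simpl.
      apply Rmult_le_reg_r with (1 - 2 * q); [lra|].
      replace (2 / (1 - 2 * q) * (1 - 2 * q)) with 2 by (field; lra); lra.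
    - rewrite Nat.pow_succ_r', Nat.mul_comm.
      apply Rle_trans with (1 := Hd _).
      replace (2 / (1 - 2 * q)) with (2 + 2 * q * (2 / (1 - 2 * q))) by (field; lra).
      nra. }
  apply Rle_trans with (2 := Hpow n); apply rsum_le_index; [exact Hv|].
  apply Nat.lt_le_incl, Nat.pow_gt_lin_r; lia.
Qed.

Lemma interval_position (m : nat) rho t :
  0 < rho -> Rabs t < rho * (INR m / 2) -> exists a, (a < m)%nat /\
    rho * (INR a - INR m / 2) <= t <= rho * (INR a + 1 - INR m / 2).
Proof.
  intros Hrho Ht; apply Rabs_def2 in Ht.
  set (z := t / rho + INR m / 2).
  assert (Ez : rho * z = t + rho * (INR m / 2)) by (unfold z; field; lra).
  assert (Hz : 0 < z < INR m) by nra.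
  destruct (base_Int_part z) as [H1 H2].
  assert (H0 : (0 <= Int_part z)%Z).
  { assert (IZR (-1) < IZR (Int_part z)) by lra. apply lt_IZR in H; lia. }
  exists (Z.to_nat (Int_part z)).
  assert (E : INR (Z.to_nat (Int_part z)) = IZR (Int_part z))
    by (rewrite INR_IZR_INZ, Z2Nat.id; auto).
  split; [apply INR_lt; lra|].
  rewrite E; nra.
Qed.

Definition plane_cell (rho : R) (m a b : nat) (p : R * R) : Prop :=
  rho * (INR a - INR m / 2) <= fst p <= rho * (INR a + 1 - INR m / 2) /\
  rho * (INR b - INR m / 2) <= snd p <= rho * (INR b + 1 - INR m / 2).

Lemma plane_cell_diam rho m a b :
  0 < rho -> diam_le (plane_cell rho m a b) (2 * rho).
Proof.
  intros Hrho p q [Hp1 Hp2] [Hq1 Hq2]; unfold dist2.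
  rewrite <- (sqrt_pow2 (2 * rho)) by lra; apply sqrt_le_1_alt.
  assert (- rho <= fst p - fst q <= rho) by lra.
  assert (- rho <= snd p - snd q <= rho) by lra.
  nra.
Qed.

(* For [4^k <= n < 2 * 4^k], the [n]-th set is a cell of the [2^k] by [2^k] grid
   of mesh [C om^(2k) / 2] centred at the origin.  These grids exhaust the plane
   when [2 om^2 > 1], and the [s]-sum converges when [2 om^s < 1]. *)
Lemma plane_null s E : 2 < s -> hausdorff_null s E.
Proof.
  intros Hs eps Heps.
  (* Any exponent strictly between [1 / s] and [1 / 2] gives [om = 2 ^ (-tt)] both properties
     [om ^ s < / 2] and [om ^ 2 > / 2]; this is the midpoint. *)
  set (tt := (/ s + / 2) / 2).
  assert (Hsi : 0 < / s < / 2)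
    by (split; [apply Rinv_0_lt_compat | apply Rinv_lt_contravar]; lra).
  assert (Hss : s * / s = 1) by (apply Rinv_r; lra).
  set (om := Rpower 2 (- tt)).
  assert (Hom : 0 < om) by apply Rpower_pos.
  set (q := Rpower om s).
  assert (Hq : 0 < q < / 2).
  { split; [apply Rpower_pos|]; unfold q, om; rewrite Rpower_mult.
    rewrite <- (Rpower_1 2) at 2 by lra; rewrite <- Rpower_Ropp.
    apply Rpower_lt; [lra|]; unfold tt; nra. }
  assert (Hgrow : 1 < 2 * om ^ 2).
  { rewrite <- (Rpower_pow 2) by assumption; unfold om; rewrite Rpower_mult.
    rewrite <- (Rpower_1 2) at 1 by lra; rewrite <- Rpower_plus.
    rewrite <- (Rpower_O 2) at 1 by lra; apply Rpower_lt; [lra|].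
    unfold tt; simpl INR; lra. }
  set (D := 2 / (1 - 2 * q)).
  assert (HD : 0 < D) by (apply Rdiv_lt_0_compat; lra).
  (* With this scale the whole sum is at most [C ^ s * D = eps / 2]. *)
  set (C := Rpower (eps / (2 * D)) (/ s)).
  assert (HC : 0 < C) by apply Rpower_pos.
  assert (HCs : Rpower C s = eps / (2 * D)).
  { unfold C; rewrite Rpower_mult, (Rmult_comm (/ s)), Hss.
    apply Rpower_1, Rdiv_lt_0_compat; lra. }
  set (r := fun n => C * om ^ Nat.log2 n).
  assert (Hr : forall n, 0 < r n)
    by (intros; apply Rmult_lt_0_compat; [assumption | now apply pow_lt]).
  assert (Hrs : forall n, Rpower (r n) s = eps / (2 * D) * q ^ Nat.log2 n).
  { intros n; unfold r.
    rewrite <- Rpower_mult_distr, HCs by (try apply pow_lt; assumption).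
    f_equal; unfold q.
    rewrite <- !Rpower_pow, !Rpower_mult by (try apply Rpower_pos; assumption).
    f_equal; ring. }
  set (U := fun n => let m := (2 ^ (Nat.log2 n / 2))%nat in
    plane_cell (r n / 2) m ((n - m * m) / m) ((n - m * m) mod m)).
  destruct (infinite_sum_bounded (fun n => Rpower (r n) s) (eps / 2)) as (l & Hl & Hle).
  { intros; left; apply Rpower_pos. }
  { intros n.
    rewrite (rsum_ext n _ (fun k => eps / (2 * D) * q ^ Nat.log2 k)) by auto.
    rewrite rsum_scal; pose proof (log2_weights_bounded q n Hq) as H; fold D in H.
    apply Rle_trans with (eps / (2 * D) * D); [|right; field; lra].
    apply Rmult_le_compat_l; [|exact H].
    left; apply Rdiv_lt_0_compat; lra. }
  exists U, r, l; split; [|split; [|split; [exact Hl | lra]]].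
  - intros p _.
    (* The grid of index [k] has half side [C / 4 * (2 * om ^ 2) ^ k]. It is made to exceed both
       coordinates, and the extra 1 provides the strict inequality for [interval_position]. *)
    destruct (Pow_x_infinity (2 * om ^ 2)
      ltac:(rewrite Rabs_pos_eq; lra)
      (4 / C * (Rabs (fst p) + Rabs (snd p) + 1))) as [k Hk].
    specialize (Hk k (Nat.le_refl k)).
    rewrite Rabs_pos_eq in Hk by (apply pow_le; lra).
    set (m := (2 ^ k)%nat).
    assert (Hm0 : (0 < m)%nat) by (apply Nat.neq_0_lt_0, Nat.pow_nonzero; lia).
    set (rho := C * om ^ (2 * k) / 2).
    assert (Hrho : 0 < rho)
      by (apply Rdiv_lt_0_compat; [apply Rmult_lt_0_compat; [|apply pow_lt] |]; lra).
    assert (Hbig : Rabs (fst p) + Rabs (snd p) + 1 <= rho * (INR m / 2)).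
    { replace (rho * (INR m / 2)) with (C / 4 * (2 * om ^ 2) ^ k).
      - apply Rmult_le_reg_l with (4 / C); [apply Rdiv_lt_0_compat; lra|].
        replace (4 / C * (C / 4 * (2 * om ^ 2) ^ k)) with ((2 * om ^ 2) ^ k)
          by (field; lra); lra.
      - unfold rho, m; rewrite pow_INR, Rpow_mult_distr, pow_mult.
        replace (INR 2) with 2 by (simpl; lra); field. }
    pose proof (Rabs_pos (fst p)); pose proof (Rabs_pos (snd p)).
    destruct (interval_position m rho (fst p) Hrho ltac:(lra)) as (a & Ha & Hpa).
    destruct (interval_position m rho (snd p) Hrho ltac:(lra)) as (b & Hb & Hpb).
    set (n := (m * m + (m * a + b))%nat).
    assert (Elog : Nat.log2 n = (2 * k)%nat).
    { apply Nat.log2_unique; [lia|].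
      assert (E2 : (2 ^ (2 * k) = m * m)%nat).
      { unfold m; rewrite <- Nat.pow_add_r; f_equal; lia. }
      rewrite Nat.pow_succ_r', E2; unfold n; nia. }
    exists n; unfold U.
    assert (Ek : (Nat.log2 n / 2 = k)%nat)
      by (rewrite Elog, Nat.mul_comm; apply Nat.div_mul; lia).
    cbv zeta; rewrite Ek; fold m.
    replace (n - m * m)%nat with (m * a + b)%nat by (unfold n; lia).
    rewrite <- (Nat.div_unique (m * a + b) m a b Hb eq_refl).
    rewrite <- (Nat.mod_unique (m * a + b) m a b Hb eq_refl).
    unfold r; rewrite Elog; split; assumption.
  - intros n; split; [apply Hr|].
    replace (r n) with (2 * (r n / 2)) at 1 by field.
    apply plane_cell_diam; specialize (Hr n); lra.
Qed.

Theorem theorem4 : hausdorff_dim badly_approx_set 2.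
Proof.
  split.
  - intros s [Hs Hnull]; apply Rnot_lt_le; intros Hlt.
    exact (badly_approx_not_null s (conj Hs Hlt) Hnull).
  - intros b Hb; apply Rnot_lt_le; intros Hlt.
    specialize (Hb ((b + 2) / 2)).
    assert (b <= (b + 2) / 2); [|lra].
    apply Hb; split; [lra|]; apply plane_null; lra.
Qed.
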